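(* Consider a two-dimensional quantum system (qubit) on which sequences of two measurements are performed. There are two measurement settings labelled $0,1$, each with outcomes $\pm$; measurement $x\in\{0,1\}$ is an arbitrary quantum instrument (with effects $\mathcal{E}_{\pm|x}$, positive semidefinite with $\mathcal{E}_{+|x}+\mathcal{E}_{-|x}=\mathbb{1}$), and the same instrument is used whenever setting $x$ is chosen, at either time step. Let $p(ab|xy)$ denote the probability of obtaining outcome $a$ when measurement $x$ is performed at the first time step on the initial state $\varrho_{in}$, followed by outcome $b$ when measurement $y$ is performed at the second time step on the resulting post-measurement state. Define $$\mathcal{B}_1=p(++|00)+p(++|11)+p(+-|01)+p(+-|10).$$ Fix $p,w\in[0,1]$. Let $B_1(p,w)$ be the maximal value of $\mathcal{B}_1$ over all initial qubit states $\varrho_{in}$ whose Bloch vector has length $p$ (i.e. purity $\mathcal{P}=\mathrm{tr}(\varrho_{in}^2)=\frac{1}{2}(1+p^2)$) and all pairs of instruments such that, for each $i\in\{0,1\}$, the (normalized) post-measurement state obtained after performing measurement $i$ on $\varrho_{in}$ and observing outcome $+$ has Bloch vector of length $w$ (i.e. purity $\mathcal{W}=\frac12(1+w^2)$). Then $$B_1(p,w)=\begin{cases}2, & 0\le w\le \frac{1-p}{3+p},\\[2pt] 1+\frac{1+w}{2}+\frac{(1+p)(1+w)}{4}, & \frac{1-p}{3+p}<w\le 1.\end{cases}$$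
   Context: A qubit state is written in Bloch form $\varrho=\frac12(\mathbb{1}+r\,\vec\alpha\cdot\vec\sigma)$ with $\vec\sigma$ the vector of Pauli matrices, $|\vec\alpha|=1$ and $0\le r\le 1$; $r$ is the length of the Bloch vector, and the purity is $\mathrm{tr}(\varrho^2)=\frac12(1+r^2)$. An instrument is a collection of completely positive maps, one per outcome, summing to a trace-preserving map. The probabilities factorize as $p(ab|xy)=\mathrm{tr}(\mathcal{E}_{a|x}\varrho_{in})\,\mathrm{tr}(\mathcal{E}_{b|y}\varrho_{a|x})$, where $\varrho_{a|x}$ is the normalized post-measurement state after measurement $x$ with outcome $a$. *)

(* Defs.v *)
From HB Require Import structures.
From mathcomp Require Import all_boot all_order all_algebra.
From mathcomp Require Import complex.
Set Implicit Arguments. Unset Strict Implicit. Unset Printing Implicit Defensive.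
Import Order.TTheory GRing.Theory Num.Theory.
Local Open Scope ring_scope.
Local Open Scope complex_scope.

Section Qubit.
Variable R : rcfType.
Local Notation C := (R[i]).

Definition adj m n (A : 'M[C]_(m, n)) : 'M[C]_(n, m) := map_mx Num.conj (A^T).

(* positive semidefinite 2x2 matrix: <v|A|v> is real and nonnegative *)
Definition psd (A : 'M[C]_2) : Prop :=
  forall v : 'cV[C]_2, 0 <= (adj v *m A *m v) 0 0.

Definition is_state (rho : 'M[C]_2) : Prop := psd rho /\ \tr rho = 1.

Definition purity (rho : 'M[C]_2) : C := \tr (rho *m rho).

Definition is_linear_map (Phi : 'M[C]_2 -> 'M[C]_2) : Prop :=
  forall (a : C) (A B : 'M[C]_2), Phi (a *: A + B) = a *: Phi A + Phi B.

(* positivity of an n x n block matrix with 2 x 2 blocks, i.e. of an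
   element of M_n (x) M_2 *)
Definition block_psd n (X : 'I_n -> 'I_n -> 'M[C]_2) : Prop :=
  forall v : 'I_n -> 'cV[C]_2,
    0 <= \sum_(i < n) \sum_(j < n) (adj (v i) *m X i j *m v j) 0 0.

Definition completely_positive (Phi : 'M[C]_2 -> 'M[C]_2) : Prop :=
  forall n (X : 'I_n -> 'I_n -> 'M[C]_2),
    block_psd X -> block_psd (fun i j => Phi (X i j)).

(* An instrument with two outcomes (true = '+', false = '-') for each of the
   two settings x : bool (false = 0, true = 1): Ins x a is the CP map E_{a|x}. *)
Definition is_instrument (Ins : bool -> bool -> 'M[C]_2 -> 'M[C]_2) : Prop :=
  forall x : bool,
    (forall a, is_linear_map (Ins x a) /\ completely_positive (Ins x a)) /\
    (forall A, \tr (Ins x true A + Ins x false A) = \tr A).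

(* p(ab|xy) = tr(E_{a|x} rho) tr(E_{b|y} rho_{a|x}) = tr(E_{b|y}(E_{a|x}(rho))) *)
Definition prob (Ins : bool -> bool -> 'M[C]_2 -> 'M[C]_2) (rho : 'M[C]_2)
  (a b x y : bool) : C := \tr (Ins y b (Ins x a rho)).

Definition B1 Ins rho : C :=
  prob Ins rho true true false false + prob Ins rho true true true true
  + prob Ins rho true false false true + prob Ins rho true false true false.

Definition post_state (Ins : bool -> bool -> 'M[C]_2 -> 'M[C]_2) rho x a :=
  (\tr (Ins x a rho))^-1 *: Ins x a rho.

(* feasible configurations: initial state with Bloch length p, both
   '+'-post-measurement states (which must exist, i.e. have nonzero
   probability) with Bloch length w *)
Definition feasible (p w : R) Ins rho : Prop :=
  is_state rho /\ purity rho = ((1 + p ^+ 2) / 2)%:C /\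
  is_instrument Ins /\
  forall x : bool, \tr (Ins x true rho) != 0 /\
     purity (post_state Ins rho x true) = ((1 + w ^+ 2) / 2)%:C.

Definition B1_value (p w : R) : R :=
  if w <= (1 - p) / (3 + p) then 2
  else 1 + (1 + w) / 2 + (1 + p) * (1 + w) / 4.

End Qubit.

(* Main.v *)
Require Import Defs.
From HB Require Import structures.
From mathcomp Require Import all_boot all_order all_algebra.
From mathcomp Require Import complex ring lra.
Set Implicit Arguments. Unset Strict Implicit. Unset Printing Implicit Defensive.
Import Order.TTheory GRing.Theory Num.Theory.
Local Open Scope ring_scope.
Local Open Scope complex_scope.

(* Write the '+' effects as E_x = a_x 1 + b_x . sigma, and put de = a_0 - a_1,
   D = |b_0 - b_1|. Optimizing over the directions of the post-measurement Bloch
   vectors gives, for an input with Bloch vector p e,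
     B_1 <= F(p, w) = (a_0 + p b_0.e) (1 + de + w D)
                      + (a_1 + p b_1.e) (1 - de + w D).
   For fixed effects F is affine in p and in w, so it suffices to bound it for
   w = 0 (by 2), on the curve w = (1 - p) / (3 + p) where the two branches meet
   (by 2), and at (p, w) = (0, 1) and (1, 1) (by 5/2 and 3).
   By symmetry de >= 0. If D <= de, then E_0 - E_1 >= 0 and replacing E_0 by the
   identity costs nothing. Otherwise, with c = 1 + w D and
   Y = c (2 - a_0 - a_1) - de^2,
     F = 2 c - Y + p ((c + de) b_0.e + (c - de) b_1.e),
   and Cauchy-Schwarz with |b_x| <= 1 - a_x bounds the square of the last bracket
   by Y^2 - (c^2 - de^2) (D^2 - de^2); a similar bound uses |b_1| <= a_1. What
   remains are polynomial inequalities in D and de. The maximum is reached by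
   diagonal measure-and-prepare instruments. *)

(** * The scalar optimization *)

Section Scalar.
Variable R : rcfType.
Implicit Types p w : R.

(* Value of B_1 when the input has Bloch vector [p e] and the post-measurement
   Bloch vectors, of length [w], point along [b_0 - b_1] and [b_1 - b_0]. *)
Definition score p w (a0 a1 x0 x1 D : R) :=
  (a0 + p * x0) * (1 + (a0 - a1) + w * D) +
  (a1 + p * x1) * (1 - (a0 - a1) + w * D).

(* Scalar shadow of the effects [a_x 1 + b_x . sigma] and of a unit vector [e]:
   [n_x = |b_x|], [x_x = b_x . e] and [D = |b_0 - b_1|]; [ep_CS] is the
   Cauchy-Schwarz inequality for [s b_0 + t b_1] against [e]. *)
Record effect_pair (a0 a1 n0 n1 x0 x1 D : R) : Prop := EffectPair {
  ep_n0 : 0 <= n0; ep_n1 : 0 <= n1;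
  ep_n0a : n0 <= a0; ep_n1a : n1 <= a1;
  ep_n0g : n0 <= 1 - a0; ep_n1g : n1 <= 1 - a1;
  ep_x0 : - n0 <= x0 <= n0; ep_x1 : - n1 <= x1 <= n1;
  ep_D : 0 <= D <= n0 + n1;
  ep_xD : - D <= x0 - x1 <= D;
  ep_CS : forall s t : R, (s * x0 + t * x1) ^+ 2 <=
    (s + t) * (s * n0 ^+ 2 + t * n1 ^+ 2) - s * t * D ^+ 2 }.

Lemma effect_pair_swap a0 a1 n0 n1 x0 x1 D :
  effect_pair a0 a1 n0 n1 x0 x1 D -> effect_pair a1 a0 n1 n0 x1 x0 D.
Proof.
case=> h1 h2 h3 h4 h5 h6 h7 h8 h9 h10 h11; split=> //; try lra.
by move=> s t; have := h11 t s; lra.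
Qed.

Lemma score_swap p w a0 a1 x0 x1 D :
  score p w a1 a0 x1 x0 D = score p w a0 a1 x0 x1 D.
Proof. by rewrite /score; ring. Qed.

Lemma ler_of_sqr (x y : R) : 0 <= y -> x ^+ 2 <= y ^+ 2 -> x <= y.
Proof.
move=> y0 h; rewrite leNgt; apply/negP => yx.
have : y * y < x * x by apply: ltr_pM.
by rewrite -!expr2 ltNge h.
Qed.

(** With [l = D + de] and [m = D - de], this is what both Cauchy-Schwarz estimates in
    [score_pure_corner] come down to. *)
Lemma corner_poly (l m : R) : 0 <= m -> m <= l -> l <= 1 ->
  0 <= (2 - l) ^+ 2 - (2 - l) * l * (l - m) - (1 - l ^+ 2) * (1 + m) ^+ 2.
Proof.
move=> m0 ml l1.
have P0 : 0 <= (1 - l) * (3 - l - l ^+ 2) by apply: mulr_ge0; nra.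
have Pl : 0 <= l ^+ 4 + 2 * l ^+ 3 + l ^+ 2 - 6 * l + 3.
  (* Completing squares: with [31 / 25] and [22 / 31] both squares are small near the minimum of the
     quartic, at [l] about 0.72, and a positive constant remains. *)
  have -> : l ^+ 4 + 2 * l ^+ 3 + l ^+ 2 - 6 * l + 3 =
    (l ^+ 2 + l - 31 / 25) ^+ 2 + 62 / 25 * (l - 22 / 31) ^+ 2 +
    (914 / 625 - 62 / 25 * (22 / 31) ^+ 2) by field.
  have := sqr_ge0 (l ^+ 2 + l - 31 / 25); have := sqr_ge0 (l - 22 / 31); lra.
have [->|lN] := eqVneq l 0; first by nra.
have lp : 0 < l by lra.
rewrite -(pmulr_rge0 _ lp).
(* The expression is concave in [m], so interpolate between [m = 0] and [m = l]. *)
have -> : l * ((2 - l) ^+ 2 - (2 - l) * l * (l - m)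
      - (1 - l ^+ 2) * (1 + m) ^+ 2) =
    m * (l ^+ 4 + 2 * l ^+ 3 + l ^+ 2 - 6 * l + 3)
    + (l - m) * ((1 - l) * (3 - l - l ^+ 2))
    + l * (1 - l ^+ 2) * m * (l - m) by ring.
have l2 : 0 <= 1 - l ^+ 2 by nra.
by rewrite !addr_ge0 // !mulr_ge0 //; lra.
Qed.

(** * Polynomial inequalities on the curve where the two branches meet *)

Section Curve.
Variables (p w de D : R).
Hypotheses (w_ge0 : 0 <= w) (w_le : 3 * w <= 1).
(* Equivalently [w = (1 - p) / (3 + p)], where the two branches of
   [B1_value] meet. *)
Hypothesis pwE : p * (1 + w) = 1 - 3 * w.
Hypothesis de_ge0 : 0 <= de.

Lemma curve_definite : 0 <= D -> D <= de -> D + de <= 1 ->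
  2 * (1 + w * D) - (1 + w * D - de) * (de - p * D) <= 2.
Proof.
have [w0 w3 pw] := And3 w_ge0 w_le pwE.
move=> D0 dD Dde.
have wp : 0 < 1 + w by lra.
(* Multiplying by [1 + w] lets [pwE] eliminate [p]. *)
rewrite -(ler_pM2r wp).
set e := de - D; have e0 : 0 <= e by rewrite /e; lra.
have -> : de = D + e by rewrite /e; ring.
have e1 : e <= 1 - 2 * D by rewrite /e; lra.
have -> : (2 * (1 + w * D) - (1 + w * D - (D + e)) * (D + e - p * D)) * (1 + w) =
  2 * (1 + w * D) * (1 + w)
  - (1 + w * D - (D + e)) * ((D + e) * (1 + w) - p * (1 + w) * D) by ring.
rewrite pw.
have k1 : 0 <= w * D * ((1 - w) * (1 - 2 * D - e)).
  by rewrite !mulr_ge0 //; lra.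
have k2 : 0 <= (1 + w) * e * (1 - 2 * D - e) by rewrite !mulr_ge0 //; lra.
have k3 : 0 <= (1 + w) * (1 - w) * (e * D) by rewrite !mulr_ge0 //; lra.
nra.
Qed.

(** Case of the least [Y], namely [c D - de^2] with [c = 1 + w D], where the Cauchy-Schwarz bound on
    the bracket is exactly [de (c - D)]. *)
Lemma curve_boundary : de <= D -> D + de <= 1 ->
  2 * (1 + w * D) - ((1 + w * D) * D - de ^+ 2)
  + p * (de * (1 + w * D - D)) <= 2.
Proof.
have [w0 w3 pw] := And3 w_ge0 w_le pwE.
have de0 := de_ge0.
move=> Dd Dde.
have wp : 0 < 1 + w by lra.
rewrite -(ler_pM2r wp) [(_ + p * _) * _]mulrDl [p * _ * _]mulrAC pw.
have q : 0 <= 1 - (1 - w) * D by nra.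
have [l|l] := lerP D (1 / 2).
  have k1 : 0 <= (1 + w) * ((D - de) * (D + de)) by rewrite !mulr_ge0 //; lra.
  have k2 : 0 <= (1 - 3 * w) * (D - de) * (1 - (1 - w) * D).
    by rewrite !mulr_ge0 //; lra.
  have k3 : 0 <= w * (1 - w) * D * (1 - 2 * D) by rewrite !mulr_ge0 //; lra.
  lra.
have k1 : 0 <= (1 + w) * ((1 - D - de) * (1 - D + de)).
  by rewrite !mulr_ge0 //; lra.
have k2 : 0 <= (1 - 3 * w) * (1 - D - de) * (1 - (1 - w) * D).
  by rewrite !mulr_ge0 //; lra.
have k3 : 0 <= (1 - w) * (2 * D - 1) * (1 + (1 - (1 - w) * D)).
  by rewrite !mulr_ge0 //; lra.
lra.
Qed.

(** Makes the discriminant of [(Y - 2 w D)^2 - p^2 (Y^2 - K)] in [Y] nonpositive, where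
    [K = (c^2 - de^2) (D^2 - de^2)]. *)
Lemma curve_discriminant c : 0 <= p <= 1 -> de < D -> D + de <= 1 -> 1 <= c ->
  de * (c - D) <= p * (c * D - de ^+ 2) ->
  4 * w ^+ 2 * D ^+ 2 <=
  (1 - p ^+ 2) * ((c ^+ 2 - de ^+ 2) * (D ^+ 2 - de ^+ 2)).
Proof.
have [w0 w3 pw] := And3 w_ge0 w_le pwE.
have de0 := de_ge0.
move=> hp Dd Dde c1 br.
have wp2 : 0 < (1 + w) ^+ 2 by rewrite exprn_gt0 //; lra.
have p2 : (1 - p ^+ 2) * (1 + w) ^+ 2 = 8 * w * (1 - w).
  by rewrite mulrBl mul1r -exprMn pw; ring.
have p1 : 0 <= 1 - p ^+ 2 by nra.
have pde : 0 <= p * de by apply: mulr_ge0; lra.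
have cp : 0 < c + p * de by lra.
have cc : 0 <= c ^+ 2 - de ^+ 2 by nra.
have m1 : 2 * w * (c + p * de) <= (1 - p ^+ 2) * (c ^+ 2 - de ^+ 2).
  rewrite -(ler_pM2r wp2) [leRHS]mulrAC p2.
  have -> : 2 * w * (c + p * de) * (1 + w) ^+ 2 =
    2 * w * ((1 + w) * (c * (1 + w) + p * (1 + w) * de)) by ring.
  have -> : 8 * w * (1 - w) * (c ^+ 2 - de ^+ 2) =
    2 * w * (4 * (1 - w) * (c ^+ 2 - de ^+ 2)) by ring.
  rewrite pw; apply: ler_wpM2l; first lra.
  have k1 : 0 <= (c - 1) * (4 * (1 - w) * (c + 1) - (1 + w) ^+ 2).
    by apply: mulr_ge0; nra.
  have k2 : 0 <= (1 - w) * (de * (1 - 2 * de)) by rewrite !mulr_ge0 //; lra.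
  have k3 : 0 <= w * (1 - 3 * w) by rewrite mulr_ge0 //; lra.
  have k4 : 0 <= (1 - 3 * w) * de by rewrite mulr_ge0 //; lra.
  nra.
(* Uses (c + p de)^2 - (de + p c)^2 = (1 - p^2) (c^2 - de^2). *)
have m2 : D ^+ 2 * ((1 - p ^+ 2) * (c ^+ 2 - de ^+ 2)) <=
    (c + p * de) ^+ 2 * (D ^+ 2 - de ^+ 2).
  (* The last hypothesis, rearranged and squared. *)
  have : (de * (c + p * de)) ^+ 2 <= (D * (de + p * c)) ^+ 2.
    have pc : 0 <= p * c by apply: mulr_ge0; lra.
    by rewrite ler_sqr ?nnegrE; [lra|apply: mulr_ge0; lra|apply: mulr_ge0; lra].
  lra.
rewrite -(ler_pM2l (exprn_gt0 2 cp)).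
have m3 : (2 * w * (c + p * de)) ^+ 2 <=
    ((1 - p ^+ 2) * (c ^+ 2 - de ^+ 2)) ^+ 2.
  by rewrite ler_sqr ?nnegrE // mulr_ge0 //; lra.
have := ler_wpM2l (sqr_ge0 D) m3.
have := ler_wpM2l (mulr_ge0 p1 cc) m2.
lra.
Qed.

End Curve.

(** * Bounds on the score for given effects *)

Section Pair.
Variables (de a1 n0 n1 x0 x1 D : R).
Hypothesis EP : effect_pair (a1 + de) a1 n0 n1 x0 x1 D.
Hypothesis de_ge0 : 0 <= de.

(** With [s_x = a_x + p x_x] and [c = 1 + w D] the score is [2 c s_0 - (c - de) (de + p (x0 - x1))];
    then [s_0 <= 1] and [x0 - x1 >= - D]. *)
Lemma score_definite p w : 0 <= p <= 1 -> 0 <= w ->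
  score p w (a1 + de) a1 x0 x1 D <=
  2 * (1 + w * D) - (1 + w * D - de) * (de - p * D).
Proof.
have de0 := de_ge0.
case: EP => h1 h2 h3 h4 h5 h6 h7 h8 h9 h10 _ hp w0.
have cde : 0 <= 1 + w * D - de by nra.
have wD : 0 <= w * D by apply: mulr_ge0; lra.
have k1 : 0 <= (1 - (a1 + de) - p * x0) * (1 + w * D).
  by apply: mulr_ge0; [nra|lra].
have k2 : 0 <= (1 + w * D - de) * (p * (D + (x0 - x1))).
  by apply: mulr_ge0 => //; apply: mulr_ge0; lra.
rewrite /score; move: k1 k2; nra.
Qed.

Lemma scoreE p w : score p w (a1 + de) a1 x0 x1 D =
  2 * (1 + w * D) - ((1 + w * D) * (2 - (a1 + de) - a1) - de ^+ 2)
  + p * ((1 + w * D + de) * x0 + (1 + w * D - de) * x1).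
Proof. by rewrite /score; ring. Qed.

Lemma CS_complement c : de <= c ->
  ((c + de) * x0 + (c - de) * x1) ^+ 2 <=
  (c * (2 - (a1 + de) - a1) - de ^+ 2) ^+ 2
  - (c ^+ 2 - de ^+ 2) * (D ^+ 2 - de ^+ 2).
Proof.
have de0 := de_ge0.
case: EP => h1 h2 h3 h4 h5 h6 h7 h8 h9 h10 CS cde.
apply: le_trans (CS _ _) _.
have e0 : n0 ^+ 2 <= (1 - (a1 + de)) ^+ 2 by rewrite ler_sqr ?nnegrE //; lra.
have e1 : n1 ^+ 2 <= (1 - a1) ^+ 2 by rewrite ler_sqr ?nnegrE //; lra.
have c0 : 0 <= c by lra.
have k0 : 0 <= c * (c + de) * ((1 - (a1 + de)) ^+ 2 - n0 ^+ 2).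
  by rewrite !mulr_ge0 //; lra.
have k1 : 0 <= c * (c - de) * ((1 - a1) ^+ 2 - n1 ^+ 2).
  by rewrite !mulr_ge0 //; lra.
rewrite -subr_ge0.
suff -> : (c * (2 - (a1 + de) - a1) - de ^+ 2) ^+ 2 -
  (c ^+ 2 - de ^+ 2) * (D ^+ 2 - de ^+ 2) -
  ((c + de + (c - de)) * ((c + de) * n0 ^+ 2 + (c - de) * n1 ^+ 2) -
   (c + de) * (c - de) * D ^+ 2) =
  2 * (c * (c + de) * ((1 - (a1 + de)) ^+ 2 - n0 ^+ 2))
  + 2 * (c * (c - de) * ((1 - a1) ^+ 2 - n1 ^+ 2)) by lra.
by ring.
Qed.

(** Same weights in [ep_CS], but with [n1 <= a1], which is sharper than [n1 <= 1 - a1] when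
    [a1 < 1/2]. *)
Lemma CS_mixed c : de <= c ->
  ((c + de) * x0 + (c - de) * x1) ^+ 2 <=
  (c * ((a1 + de) + a1 - 1) - de * (1 - de)) ^+ 2
  + (c ^+ 2 - de ^+ 2) * ((1 - de) ^+ 2 - D ^+ 2).
Proof.
have de0 := de_ge0.
case: EP => h1 h2 h3 h4 h5 h6 h7 h8 h9 h10 CS cde.
apply: le_trans (CS _ _) _.
have e0 : n0 ^+ 2 <= (1 - (a1 + de)) ^+ 2 by rewrite ler_sqr ?nnegrE //; lra.
have e1 : n1 ^+ 2 <= a1 ^+ 2 by rewrite ler_sqr ?nnegrE //; lra.
have c0 : 0 <= c by lra.
have k0 : 0 <= c * (c + de) * ((1 - (a1 + de)) ^+ 2 - n0 ^+ 2).
  by rewrite !mulr_ge0 //; lra.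
have k1 : 0 <= c * (c - de) * (a1 ^+ 2 - n1 ^+ 2).
  by rewrite !mulr_ge0 //; lra.
rewrite -subr_ge0.
suff -> : (c * ((a1 + de) + a1 - 1) - de * (1 - de)) ^+ 2
  + (c ^+ 2 - de ^+ 2) * ((1 - de) ^+ 2 - D ^+ 2) -
  ((c + de + (c - de)) * ((c + de) * n0 ^+ 2 + (c - de) * n1 ^+ 2) -
   (c + de) * (c - de) * D ^+ 2) =
  2 * (c * (c + de) * ((1 - (a1 + de)) ^+ 2 - n0 ^+ 2))
  + 2 * (c * (c - de) * (a1 ^+ 2 - n1 ^+ 2)) by lra.
by ring.
Qed.

Lemma dist_bounds : [/\ 0 <= D, D + de <= 1 & D <= 2 - (a1 + de) - a1].
Proof. by case: EP => *; split; lra. Qed.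

Lemma score_mixed_corner : score 0 1 (a1 + de) a1 x0 x1 D <= 5 / 2.
Proof.
have de0 := de_ge0.
have [D0 Dde Ds] := dist_bounds.
have [dD|Dd] := lerP D de.
  apply: le_trans (score_definite _ _) _; [lra|lra|].
  by rewrite !mul1r mul0r subr0; nra.
rewrite scoreE mul1r mul0r addr0.
have k : 0 <= (1 + D) * ((2 - (a1 + de) - a1) - D) by apply: mulr_ge0; lra.
(* The score is at most [2 + D - D^2 + de^2]; use [de < D] for small [D] and [de <= 1 - D]
   otherwise. *)
have [l|l] := lerP D (1 / 2); first by nra.
by have : de ^+ 2 <= (1 - D) ^+ 2; [rewrite ler_sqr ?nnegrE //; lra|nra].
Qed.

Lemma score_pure_corner : score 1 1 (a1 + de) a1 x0 x1 D <= 3.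
Proof.
have de0 := de_ge0.
have [D0 Dde Ds] := dist_bounds.
have [dD|Dd] := lerP D de.
  apply: le_trans (score_definite _ _) _; [lra|lra|].
  by rewrite !mul1r; nra.
have P := @corner_poly (D + de) (D - de) ltac:(lra) ltac:(lra) ltac:(lra).
rewrite scoreE !mul1r.
have cde : de <= 1 + D by lra.
have [g1|g1] := lerP (1 / 2) a1.
  have Z := CS_complement cde.
  set z := _ * x0 + _ in Z *.
  set Y := _ - de ^+ 2 in Z *.
  suff : z <= Y - (2 * D - 1) by lra.
  have Y0 : (1 + D) * D - de ^+ 2 <= Y by rewrite /Y; nra.
  have Y1 : Y <= (1 + D) * (1 - de) - de ^+ 2.
    by rewrite /Y lerD2r; apply: ler_wpM2l; lra.
  apply: ler_of_sqr; first by nra.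
  apply: le_trans Z _.
  have K0 : 0 <= ((1 + D) ^+ 2 - de ^+ 2) * (D ^+ 2 - de ^+ 2).
    by apply: mulr_ge0; nra.
  have Yge : 0 <= Y by nra.
  (* What remains is [2 (2 D - 1) Y <= K + (2 D - 1)^2], [K] being the product in [K0]; the sign of
     [2 D - 1] decides which bound on [Y] is needed. *)
  have [q|q] := lerP (2 * D - 1) 0.
    have : 0 <= (1 - 2 * D) * Y by apply: mulr_ge0; lra.
    by have := sqr_ge0 (2 * D - 1); nra.
  have : 0 <= (2 * D - 1) * ((1 + D) * (1 - de) - de ^+ 2 - Y).
    by apply: mulr_ge0; lra.
  move: P; nra.
have Z := CS_mixed cde.
set z := _ * x0 + _ in Z *.
set Y := _ - de * (1 - de) in Z.
have -> : 2 * (1 + D) - ((1 + D) * (2 - (a1 + de) - a1) - de ^+ 2) + z =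
    1 + D + de + Y + z.
  by rewrite /Y; ring.
suff : z <= 2 - D - de - Y by lra.
have Y1 : Y <= de * (D + de).
  have : (1 + D) * ((a1 + de) + a1 - 1) <= (1 + D) * de by apply: ler_wpM2l; lra.
  by rewrite /Y; lra.
apply: ler_of_sqr; first by nra.
apply: le_trans Z _.
have : 0 <= (2 - D - de) * (de * (D + de) - Y) by apply: mulr_ge0; lra.
move: P; nra.
Qed.

Lemma score_curve p w : 0 <= p <= 1 -> 0 <= w -> 3 * w <= 1 ->
  p * (1 + w) = 1 - 3 * w -> score p w (a1 + de) a1 x0 x1 D <= 2.
Proof.
have de0 := de_ge0.
move=> hp w0 w3 pw.
have [D0 Dde Ds] := dist_bounds.
have [dD|Dd] := lerP D de.
  by apply: le_trans (score_definite hp w0) _; apply: curve_definite.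
set c := 1 + w * D.
have c1 : 1 <= c by rewrite /c lerDl mulr_ge0.
have cD : c <= 1 + D by rewrite /c; nra.
have cde : de <= c by lra.
rewrite scoreE -/c.
have Z := CS_complement cde.
set z := _ * x0 + _ in Z *.
set Y := _ - de ^+ 2 in Z *.
have Y0 : c * D - de ^+ 2 <= Y by rewrite /Y; nra.
(* The bound [p sqrt(Y^2 - K) - Y] is concave in [Y]; its slope at the least [Y] decides whether the
   maximum lies there or further inside. *)
have [br|br] := lerP (p * (c * D - de ^+ 2)) (de * (c - D)).
  have F0 := curve_boundary w0 w3 pw de0 (ltW Dd) Dde.
  rewrite -/c in F0.
  suff : p * z <= p * (de * (c - D)) + (Y - (c * D - de ^+ 2)) by lra.
  have d0 : 0 <= p * (de * (c - D)) by rewrite !mulr_ge0 //; lra.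
  apply: ler_of_sqr; first lra.
  rewrite exprMn; apply: le_trans (ler_wpM2l (sqr_ge0 p) Z) _.
  have h0 : 0 <= Y - (c * D - de ^+ 2) by lra.
  set h := Y - (c * D - de ^+ 2) in h0 *.
  have -> : Y = h + (c * D - de ^+ 2) by rewrite /h; ring.
  have k1 : 0 <= p * h * (de * (c - D) - p * (c * D - de ^+ 2)).
    by rewrite !mulr_ge0 //; lra.
  have k2 : 0 <= (1 - p) * (1 + p) * h ^+ 2.
    by rewrite !mulr_ge0 ?sqr_ge0 //; lra.
  lra.
suff : p * z <= Y - 2 * w * D by rewrite /c; lra.
have key := curve_discriminant w0 w3 pw de0 hp Dd Dde c1 (ltW br).
have Yw : 0 <= Y - 2 * w * D.
  suff : 0 <= c * D - de ^+ 2 - 2 * w * D by lra.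
  have k1 : 0 <= D * (1 - 3 * w) by rewrite mulr_ge0 //; lra.
  have [l|l] := lerP D (1 / 2).
    have : 0 <= (1 - w) * D * (1 - 2 * D) by rewrite !mulr_ge0 //; lra.
    have : 0 <= (D - de) * (D + de) by apply: mulr_ge0; lra.
    rewrite /c; lra.
  have : 0 <= (1 - D - de) * D + de * (D - de).
    by rewrite addr_ge0 ?mulr_ge0 //; lra.
  have : 0 <= D * ((1 + w) * (2 * D - 1)) by rewrite !mulr_ge0 //; lra.
  rewrite /c; lra.
apply: ler_of_sqr => //.
rewrite exprMn; apply: le_trans (ler_wpM2l (sqr_ge0 p) Z) _.
set K := (c ^+ 2 - de ^+ 2) * (D ^+ 2 - de ^+ 2) in key *.
have K0 : 0 <= K by apply: mulr_ge0; nra.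
have [p1|p1] := eqVneq p 1.
  have w_0 : w = 0 by move: pw; rewrite p1; lra.
  by rewrite w_0 p1; lra.
have p2 : 0 < 1 - p ^+ 2.
  have : p < 1 by rewrite lt_neqAle p1; case/andP: hp.
  by nra.
(* Times [1 - p^2], the difference is a completed square in [Y] plus the discriminant term
   controlled by [key]. *)
rewrite -subr_ge0 -(pmulr_rge0 _ p2).
have -> : (1 - p ^+ 2) * ((Y - 2 * w * D) ^+ 2 - p ^+ 2 * (Y ^+ 2 - K)) =
  ((1 - p ^+ 2) * Y - 2 * w * D) ^+ 2
  + p ^+ 2 * ((1 - p ^+ 2) * K - 4 * w ^+ 2 * D ^+ 2) by ring.
by rewrite addr_ge0 ?sqr_ge0 // mulr_ge0 ?sqr_ge0 // subr_ge0.
Qed.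

End Pair.

Lemma score_le p w a0 a1 n0 n1 x0 x1 D : 0 <= p <= 1 -> 0 <= w <= 1 ->
  effect_pair a0 a1 n0 n1 x0 x1 D ->
  score p w a0 a1 x0 x1 D <= B1_value p w.
Proof.
wlog a10 : a0 a1 n0 n1 x0 x1 / a1 <= a0 => [th|] hp hw EP.
  have [a01|/ltW a01] := lerP a1 a0; first exact: (th _ _ n0 n1).
  rewrite -score_swap; apply: (th _ _ n1 n0) => //.
  exact: effect_pair_swap.
have [de de0 Ea0] : exists2 de, 0 <= de & a0 = a1 + de.
  by exists (a0 - a1); [lra|ring].
rewrite {}Ea0 in EP *.
have G0 := score_mixed_corner EP de0.
have G1 := score_pure_corner EP de0.
have p3 : 0 < 3 + p by lra.
set wc := (1 - p) / (3 + p).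
have wcE : wc * (3 + p) = 1 - p by rewrite /wc divfK // gt_eqF.
have wc0 : 0 <= wc by rewrite /wc divr_ge0 //; lra.
have wc3 : 3 * wc <= 1.
  rewrite /wc mulrA ler_pdivrMr //; lra.
have Gc := score_curve EP de0 hp wc0 wc3 ltac:(lra).
have S0 : score p 0 (a1 + de) a1 x0 x1 D <= 2.
  case: EP => h1 h2 h3 h4 h5 h6 h7 h8 h9 h10 _.
  have q0 : (a1 + de + p * x0) <= 1 by nra.
  have q1 : a1 + p * x1 <= 1 by nra.
  rewrite /score mul0r !addr0 -[2]/(1 + 1 : R).
  have k1 : 0 <= (1 - (a1 + de + p * x0)) * (1 + de) by apply: mulr_ge0; lra.
  have k2 : 0 <= (1 - (a1 + p * x1)) * (1 - de) by apply: mulr_ge0; lra.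
  lra.
have [A [B SE]] : exists A B, forall w, score p w (a1 + de) a1 x0 x1 D = A + w * B.
  exists (score p 0 (a1 + de) a1 x0 x1 D).
  by exists ((a1 + de + p * x0 + (a1 + p * x1)) * D) => v; rewrite /score; ring.
have S1 : score p 1 (a1 + de) a1 x0 x1 D <= 5 / 2 + p / 2.
  move: G0 G1.
  have [A' [B' SE']] : exists A B,
      forall p, score p 1 (a1 + de) a1 x0 x1 D = A + p * B.
    exists (score 0 1 (a1 + de) a1 x0 x1 D).
    exists (x0 * (1 + de + D) + x1 * (1 - de + D)) => v; rewrite /score; ring.
  rewrite !SE' => G0 G1; nra.
move: Gc S0 S1; rewrite !SE => Gc S0 S1.
rewrite /B1_value -/wc; case: ifPn => [wwc|].
  have [B0|B0] := lerP B 0; first by nra.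
  have : (wc - w) * B >= 0 by apply: mulr_ge0; lra.
  lra.
rewrite -ltNge => wcw.
have wc1 : 0 < 1 - wc by lra.
(* The second branch is the chord from [(wc, 2)] to [(1, 5/2 + p/2)]; interpolate with weights
   [1 - w] and [w - wc]. *)
rewrite -(ler_pM2l wc1).
have k1 : 0 <= (1 - w) * (2 - (A + wc * B)) by apply: mulr_ge0; lra.
have k2 : 0 <= (w - wc) * (5 / 2 + p / 2 - (A + 1 * B)) by apply: mulr_ge0; lra.
have e1 : wc * (3 + p) * w = (1 - p) * w by rewrite wcE.
lra.
Qed.
End Scalar.

(** * Bloch representation *)

Section Bloch.
Variable R : rcfType.
Local Notation C := (R[i]).
Local Notation vec := (R * R * R)%type.

Definition dot (u v : vec) : R := u.1.1 * v.1.1 + u.1.2 * v.1.2 + u.2 * v.2.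
(** Scaling by [k] is written [lin k u 0 u]. *)
Definition lin (s : R) (u : vec) (t : R) (v : vec) : vec :=
  (s * u.1.1 + t * v.1.1, s * u.1.2 + t * v.1.2, s * u.2 + t * v.2).
Definition len (u : vec) : R := Num.sqrt (dot u u).

Lemma dotC u v : dot u v = dot v u.
Proof. by rewrite /dot; ring. Qed.

Lemma dot_lin s u t v x : dot (lin s u t v) x = s * dot u x + t * dot v x.
Proof. by rewrite /dot /lin /=; ring. Qed.

Lemma dot_ge0 u : 0 <= dot u u.
Proof. by rewrite /dot -!expr2 !addr_ge0 ?sqr_ge0. Qed.

Lemma len_ge0 u : 0 <= len u.
Proof. exact: sqrtr_ge0. Qed.

Lemma sqr_len u : len u ^+ 2 = dot u u.
Proof. by rewrite sqr_sqrtr ?dot_ge0. Qed.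

Lemma dot_sqr_le u v : dot u v ^+ 2 <= dot u u * dot v v.
Proof.
rewrite -subr_ge0.
have -> : dot u u * dot v v - dot u v ^+ 2 =
  (u.1.1 * v.1.2 - u.1.2 * v.1.1) ^+ 2 + (u.1.1 * v.2 - u.2 * v.1.1) ^+ 2 +
  (u.1.2 * v.2 - u.2 * v.1.2) ^+ 2 by rewrite /dot; ring.
by rewrite !addr_ge0 ?sqr_ge0.
Qed.

Lemma dot_le u v (k l : R) : 0 <= k -> 0 <= l ->
  dot u u <= k ^+ 2 -> dot v v <= l ^+ 2 -> - (k * l) <= dot u v <= k * l.
Proof.
move=> k0 l0 hu hv.
rewrite -ler_norml -ler_sqr ?nnegrE ?mulr_ge0 // real_normK ?num_real //.
by rewrite (le_trans (dot_sqr_le _ _)) // exprMn ler_pM ?dot_ge0.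
Qed.

Lemma dot_len u v : - (len u * len v) <= dot u v <= len u * len v.
Proof. by apply: dot_le; rewrite ?len_ge0 ?sqr_len. Qed.

Lemma effect_pair_dot (a0 a1 : R) (b0 b1 e : vec) : dot e e = 1 ->
  len b0 <= a0 -> len b0 <= 1 - a0 -> len b1 <= a1 -> len b1 <= 1 - a1 ->
  effect_pair a0 a1 (len b0) (len b1) (dot b0 e) (dot b1 e)
    (len (lin 1 b0 (-1) b1)).
Proof.
move=> e1 h1 h2 h3 h4.
have len_e : len e = 1 by rewrite /len e1 sqrtr1.
have DE : len (lin 1 b0 (-1) b1) ^+ 2 =
    len b0 ^+ 2 + len b1 ^+ 2 - 2 * dot b0 b1.
  by rewrite !sqr_len /dot /lin /=; ring.
split; rewrite ?len_ge0 //.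
- by have := dot_len b0 e; rewrite len_e mulr1.
- by have := dot_len b1 e; rewrite len_e mulr1.
- rewrite /= -ler_sqr ?nnegrE ?addr_ge0 ?len_ge0 // DE.
  by have := dot_len b0 b1; lra.
- by have := dot_len (lin 1 b0 (-1) b1) e; rewrite dot_lin len_e; lra.
(* The squared length of [s b0 + t b1] equals the right-hand side once [DE] replaces [D^2]. *)
move=> s t; rewrite DE -dot_lin.
apply: le_trans (dot_sqr_le _ _) _; rewrite e1 mulr1 !sqr_len.
by rewrite /dot /lin /= le_eqVlt; apply/orP; left; apply/eqP; ring.
Qed.

(* [bloch t u] is [t 1 + u . sigma], so a state with Bloch vector [r] is
   [bloch (1/2) (r/2)]. *)
Definition bloch (t : R) (u : vec) : 'M[C]_2 :=
  \matrix_(i < 2, j < 2)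
    if i == 0 then (if j == 0 then (t + u.2)%:C else u.1.1 -i* u.1.2)
    else (if j == 0 then u.1.1 +i* u.1.2 else (t - u.2)%:C).

Lemma tr_mx2 (A : 'M[C]_2) : \tr A = A 0 0 + A 1 1.
Proof.
rewrite /mxtrace !big_ord_recl big_ord0 addr0.
by congr (A _ _ + A _ _); apply/val_inj.
Qed.

Lemma mul_mx2 (m n : nat) (A : 'M[C]_(m, 2)) (B : 'M[C]_(2, n)) i j :
  (A *m B) i j = A i 0 * B 0 j + A i 1 * B 1 j.
Proof.
rewrite mxE !big_ord_recl big_ord0 addr0.
by congr (_ + A _ _ * B _ _); apply/val_inj.
Qed.

Lemma mx2P (A B : 'M[C]_2) : A 0 0 = B 0 0 -> A 0 1 = B 0 1 ->
  A 1 0 = B 1 0 -> A 1 1 = B 1 1 -> A = B.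
Proof.
move=> h1 h2 h3 h4; apply/matrixP => i j.
have ord2 (k : 'I_2) : k = 0 \/ k = 1.
  by case: k => [[|[|//]] ?]; [left|right]; apply/val_inj.
by case: (ord2 i) => ->; case: (ord2 j) => ->.
Qed.

Lemma form_mx2 (A : 'M[C]_2) (u v : 'cV[C]_2) : (adj u *m A *m v) 0 0 =
  (conjc (u 0 0) * A 0 0 + conjc (u 1 0) * A 1 0) * v 0 0 +
  (conjc (u 0 0) * A 0 1 + conjc (u 1 0) * A 1 1) * v 1 0.
Proof. by rewrite !mul_mx2 !mxE. Qed.

Lemma bloch_psd t u : len u <= t -> psd (bloch t u).
Proof.
move=> ut v; rewrite form_mx2 !mxE /=.
case: (v 0 0) => a b; case: (v 1 0) => c d.
rewrite /real_complex_def; simpc.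
set n := a ^+ 2 + b ^+ 2 + c ^+ 2 + d ^+ 2.
(* The unnormalized Bloch vector of [v]; its length is [n], the squared norm of [v]. *)
set s : vec := (2 * (a * c + b * d), 2 * (a * d - b * c),
             a ^+ 2 + b ^+ 2 - c ^+ 2 - d ^+ 2).
have n0 : 0 <= n by rewrite !addr_ge0 ?sqr_ge0.
have ss : dot s s <= n ^+ 2.
  suff -> : dot s s = n ^+ 2 by [].
  by rewrite /dot /s /n /=; ring.
have t0 : 0 <= t by apply: le_trans ut; apply: len_ge0.
have tt : dot u u <= t ^+ 2 by rewrite -sqr_len ler_sqr ?nnegrE ?len_ge0.
have := dot_le t0 n0 tt ss.
rewrite /dot /s /n /= => h; apply/andP; split; last by lra.
by apply/eqP; ring.
Qed.

(** Polarization: reality of the form at four vectors forces [A] to be Hermitian. *)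
Lemma psd_bloch A : psd A -> exists (t : R) u, 0 <= t /\ A = bloch t u.
Proof.
move=> pA.
have form x y := pA (\matrix_(i, j) if i == 0 then x else y).
have {form} form x y : 0 <= (conjc x * A 0 0 + conjc y * A 1 0) * x +
  (conjc x * A 0 1 + conjc y * A 1 1) * y.
  by have := form x y; rewrite form_mx2 !mxE.
move: (form 1 0) (form 0 1) (form 1 1) (form 1 'i%C).
case E00 : (A 0 0) => [a a']; case E01 : (A 0 1) => [b b'].
case E10 : (A 1 0) => [c c']; case E11 : (A 1 1) => [d d'].
rewrite !lecE /=; simpc.
move=> /andP[/eqP h1 h2] /andP[/eqP h3 h4] /andP[/eqP h5 h6] /andP[/eqP h7 h8].
exists ((a + d) / 2), ((b + c) / 2, (c' - b') / 2, (a - d) / 2).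
split; first by lra.
apply: mx2P; rewrite mxE /= ?E00 ?E01 ?E10 ?E11 /real_complex_def.
all: by congr (_ +i* _); lra.
Qed.

Lemma tr_bloch t u : \tr (bloch t u) = (2 * t)%:C.
Proof. by rewrite tr_mx2 !mxE /= -rmorphD; congr (_%:C); ring. Qed.

Lemma purity_bloch t u : purity (bloch t u) = (2 * (t ^+ 2 + dot u u))%:C.
Proof.
rewrite /purity tr_mx2 !mul_mx2 !mxE /= /real_complex_def; simpc.
by rewrite /dot; congr (_ +i* _); ring.
Qed.

Lemma scale_bloch k t u : k%:C *: bloch t u = bloch (k * t) (lin k u 0 u).
Proof.
apply: mx2P; rewrite !mxE /= /real_complex_def; simpc; congr (_ +i* _); ring.
Qed.

Lemma functional_bloch (f : 'M[C]_2 -> C) :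
  (forall (k : C) A B, f (k *: A + B) = k * f A + f B) ->
  (forall A, psd A -> 0 <= f A) ->
  exists a b, len b <= a /\
    forall t u, f (bloch t u) = (2 * (t * a + dot b u))%:C.
Proof.
move=> fL fP.
have real0 (x : C) : 0 <= x -> exists k, x = k%:C.
  by case: x => x y; rewrite lecE /= => /andP[/eqP -> _]; exists x.
have unit_len u : dot u u = 1 -> len u <= 1 by move=> E; rewrite /len E sqrtr1.
pose X : vec := (1, 0, 0); pose Y : vec := (0, 1, 0); pose Z : vec := (0, 0, 1).
pose O : vec := (0, 0, 0).
have /real0[i fI] : 0 <= f (bloch 1 O).
  by apply/fP/bloch_psd; rewrite /len /dot /= !mul0r !addr0 sqrtr0.
have /real0[x fX] : 0 <= f (bloch 1 X).
  by apply/fP/bloch_psd/unit_len; rewrite /dot /=; ring.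
have /real0[y fY] : 0 <= f (bloch 1 Y).
  by apply/fP/bloch_psd/unit_len; rewrite /dot /=; ring.
have /real0[z fZ] : 0 <= f (bloch 1 Z).
  by apply/fP/bloch_psd/unit_len; rewrite /dot /=; ring.
have fE t (u : vec) : f (bloch t u) =
    (2 * (t * (i / 2) + dot ((x - i) / 2, (y - i) / 2, (z - i) / 2) u))%:C.
  have f0 : f 0 = 0 by have := fL (-1) 0 0; rewrite scaler0 addr0 mulN1r addNr.
  (* The basis consists of positive semidefinite matrices, so positivity of [f] made all four
     coefficients real. *)
  have -> : bloch t u = (t - u.1.1 - u.1.2 - u.2)%:C *: bloch 1 O +
    (u.1.1%:C *: bloch 1 X + (u.1.2%:C *: bloch 1 Y + (u.2%:C *: bloch 1 Z + 0))).
    apply: mx2P; rewrite !mxE /= /real_complex_def; simpc; congr (_ +i* _); ring.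
  rewrite !fL f0 fI fX fY fZ /dot /= -!rmorphM /= addr0 -!rmorphD /=.
  by congr (_%:C); field.
exists (i / 2), ((x - i) / 2, (y - i) / 2, (z - i) / 2); split=> //.
set b := (_, _, _) in fE *.
have i0 : 0 <= i.
  rewrite -ler0c -fI; apply/fP/bloch_psd.
  by rewrite /len /dot /= !mul0r !addr0 sqrtr0.
have [l0|ln] := eqVneq (len b) 0; first by rewrite l0; lra.
have lp : 0 < len b by rewrite lt_neqAle eq_sym ln len_ge0.
(* Testing [f] on [len b 1 - b . sigma], on the boundary of the positive cone, yields
   [len b <= a]. *)
pose m := lin (-1) b 0 b.
have mE v : dot v m = - dot v b by rewrite dotC dot_lin mul0r addr0 mulN1r dotC.
have lm : len m = len b by rewrite /len mE dotC mE opprK.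
have : 0 <= f (bloch (len b) m) by apply/fP/bloch_psd; rewrite lm.
rewrite fE ler0c mE -sqr_len => h.
rewrite -(ler_pM2l lp); lra.
Qed.
End Bloch.

(** * The bound and its attainment *)

Section Upper.
Variable R : rcfType.
Local Notation C := (R[i]).
Local Notation vec := (R * R * R)%type.

Lemma completely_positive_psd (Phi : 'M[C]_2 -> 'M[C]_2) (A : 'M[C]_2) :
  completely_positive Phi -> psd A -> psd (Phi A).
Proof.
move=> cp pA v.
have := cp 1%N (fun _ _ => A) _ (fun=> v).
rewrite !big_ord_recl !big_ord0 !addr0; apply=> u.
by rewrite !big_ord_recl !big_ord0 !addr0.
Qed.

(** Each outcome probability is a positive functional, and trace preservation makes the two effects
    sum to the identity. *)
Lemma instrument_effect (Ins : bool -> bool -> 'M[C]_2 -> 'M[C]_2) x :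
  is_instrument Ins -> exists a b, [/\ len b <= a, len b <= 1 - a &
    forall t u, \tr (Ins x true (bloch t u)) = (2 * (t * a + dot b u))%:C /\
      \tr (Ins x false (bloch t u)) = (2 * (t * (1 - a) - dot b u))%:C].
Proof.
move=> /(_ x) [ins trI].
have lin_tr c : forall (k : C) A B,
    \tr (Ins x c (k *: A + B)) = k * \tr (Ins x c A) + \tr (Ins x c B).
  by move=> k A B; rewrite (ins c).1 mxtraceD mxtraceZ.
have pos c A : psd A -> 0 <= \tr (Ins x c A).
  move=> /(completely_positive_psd (ins c).2) /psd_bloch [t [u [t0 ->]]].
  by rewrite tr_bloch ler0c; lra.
have [a [b [ab fE]]] := functional_bloch (lin_tr true) (pos true).
have [a' [b' [ab' fE']]] := functional_bloch (lin_tr false) (pos false).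
have sum t u : t * a + dot b u + (t * a' + dot b' u) = t.
  apply: (mulfI (x := 2)); first by rewrite pnatr_eq0.
  apply: (@complexI R); rewrite -(tr_bloch t u) -(trI (bloch t u)).
  by rewrite mxtraceD fE fE' -rmorphD; congr (_%:C); ring.
have Ea' : a' = 1 - a.
  by have := sum 1 (0, 0, 0); rewrite /dot /= !mulr0; lra.
have Eb' u : dot b' u = - dot b u by have := sum 0 u; lra.
exists a, b; split=> //.
  have : len b' = len b.
    by rewrite /len Eb' dotC Eb' opprK.
  by rewrite -Ea' => <-.
by move=> t u; rewrite fE fE' Ea' Eb'.
Qed.

Lemma B1_le (p w : R) Ins rho : 0 <= p <= 1 -> 0 <= w <= 1 ->
  feasible p w Ins rho -> B1 Ins rho <= (B1_value p w)%:C.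
Proof.
move=> hp hw [[prho trho] [purho [ins post]]].
have [t [r [t0 rhoE]]] := psd_bloch prho.
have tE : t = 1 / 2.
  move: trho; rewrite rhoE tr_bloch => /(@complexI R _ 1); lra.
have rr : dot r r = (p / 2) ^+ 2.
  move: purho; rewrite rhoE purity_bloch tE => /complexI; lra.
have [e ee re] : exists2 e, dot e e = 1 & r = lin (p / 2) e 0 e.
  have [p0|pn] := eqVneq p 0.
    exists (1, 0, 0); first by rewrite /dot /=; ring.
    move: rr; rewrite p0 mul0r expr2 mul0r /dot => /eqP.
    rewrite -!expr2 !paddr_eq0 ?addr_ge0 ?sqr_ge0 // !sqrf_eq0.
    case: (r) => [[r1 r2] r3] /= /andP[/andP[/eqP -> /eqP ->] /eqP ->].
    by rewrite /lin /= !mul0r !addr0.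
  exists (lin (2 / p) r 0 r).
    by rewrite dot_lin mul0r addr0 dotC dot_lin mul0r addr0 rr; field.
  case: (r) => [[r1 r2] r3]; rewrite /lin /= !mul0r !addr0.
  by congr (_, _, _); field.
(* Unnormalized post-measurement state: [2 s] is the probability of the outcome, and the purity
   constraint fixes the length of [u]. *)
have after x a b : len b <= a -> (forall t u,
    \tr (Ins x true (bloch t u)) = (2 * (t * a + dot b u))%:C) ->
  exists s u, [/\ 0 <= s, 2 * s = a + p * dot b e, len u = w * s &
    Ins x true rho = bloch s u].
  move=> ba fE.
  have pA := completely_positive_psd ((ins x).1 true).2 prho.
  have [s [u [s0 AE]]] := psd_bloch pA.
  exists s, u; split=> //.
    have : (2 * s)%:C = \tr (Ins x true rho) :> C by rewrite AE tr_bloch.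
    rewrite rhoE fE => /complexI ->; rewrite tE re dotC dot_lin dotC; lra.
  have [] := post x; rewrite /post_state AE tr_bloch => sn.
  have {}sn : s != 0 by apply: contraNneq sn => ->; rewrite mulr0.
  rewrite -fmorphV scale_bloch purity_bloch => /complexI uE.
  have -> : w * s = Num.sqrt ((w * s) ^+ 2).
    by rewrite sqrtr_sqr ger0_norm // mulr_ge0 //; lra.
  rewrite /len; congr Num.sqrt.
  move: uE; rewrite dot_lin mul0r addr0 dotC dot_lin mul0r addr0.
  move=> uE.
  have : (2 * s) ^+ 2 * (2 * (((2 * s)^-1 * s) ^+ 2 +
      (2 * s)^-1 * ((2 * s)^-1 * dot u u))) = (2 * s) ^+ 2 * ((1 + w ^+ 2) / 2).
    by rewrite uE.
  have -> : (2 * s) ^+ 2 * (2 * (((2 * s)^-1 * s) ^+ 2 +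
      (2 * s)^-1 * ((2 * s)^-1 * dot u u))) = 2 * (s ^+ 2 + dot u u).
    by field.
  lra.
have [a0 [b0 [l0 g0 f0]]] := instrument_effect false ins.
have [a1 [b1 [l1 g1 f1]]] := instrument_effect true ins.
have [s0 [u0 [s0p s0E u0w A0]]] := after false a0 b0 l0 (fun t u => (f0 t u).1).
have [s1 [u1 [s1p s1E u1w A1]]] := after true a1 b1 l1 (fun t u => (f1 t u).1).
have EP := effect_pair_dot ee l0 g0 l1 g1.
have := score_le hp hw EP.
set D := len (lin 1 b0 (-1) b1).
move=> hs; rewrite /B1 /prob A0 A1 (f0 _ _).1 (f1 _ _).1 (f0 _ _).2 (f1 _ _).2.
rewrite -!rmorphD /= lecR; apply: le_trans hs.
rewrite /score -s0E -s1E.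
(* Cauchy-Schwarz, tight when [u0] points along [b0 - b1] and [u1] along [b1 - b0]. *)
have d0 : dot b0 u0 - dot b1 u0 <= D * (w * s0).
  by have := dot_len (lin 1 b0 (-1) b1) u0; rewrite dot_lin u0w -/D; lra.
have d1 : dot b1 u1 - dot b0 u1 <= D * (w * s1).
  by have := dot_len (lin 1 b0 (-1) b1) u1; rewrite dot_lin u1w -/D; lra.
lra.
Qed.

End Upper.

(** * Diagonal instruments attaining the maximum *)

Section Attained.
Variable R : rcfType.
Local Notation C := (R[i]).
Local Notation bl t z := (bloch t (0, 0, z)).

(* Measures the diagonal effect diag(e0, e1) and prepares the state with Bloch
   vector (0, 0, z). *)
Definition prepare (e0 e1 z : R) (A : 'M[C]_2) : 'M[C]_2 :=
  (e0%:C * A 0 0 + e1%:C * A 1 1) *: bl (1 / 2) (z / 2).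

Lemma prepare_linear e0 e1 z : is_linear_map (prepare e0 e1 z).
Proof.
move=> a A B; rewrite /prepare !mxE scalerA -scalerDl; congr (_ *: _).
by ring.
Qed.

Lemma tr_prepare e0 e1 z A : \tr (prepare e0 e1 z A) = e0%:C * A 0 0 + e1%:C * A 1 1.
Proof. by rewrite /prepare mxtraceZ tr_bloch mulrCA divff ?mulr1 // pnatr_eq0. Qed.

Lemma prepare_cp (e0 e1 z : R) : 0 <= e0 -> 0 <= e1 -> -1 <= z <= 1 ->
  completely_positive (prepare e0 e1 z).
Proof.
move=> e00 e10 hz n X pX v.
(* Testing [X] on vectors supported in slot [k], with the [l] entry of [v] there, isolates the
   diagonal entries [X i j k k]; the form is a nonnegative combination of the four [q k l]. *)
pose q (k l : 'I_2) := \sum_(i < n) \sum_(j < n)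
  (adj (v i l 0 *: delta_mx k 0 : 'cV[C]_2) *m X i j
    *m (v j l 0 *: delta_mx k 0 : 'cV[C]_2)) 0 0.
have q0 k l : 0 <= q k l by apply: pX.
have qE k l : q k l =
    \sum_(i < n) \sum_(j < n) conjc (v i l 0) * X i j k k * v j l 0.
  apply: eq_bigr => i _; apply: eq_bigr => j _.
  rewrite form_mx2 !mxE.
  have k01 : k = 0 \/ k = 1.
    by case: k => [[|[|//]] ?]; [left|right]; apply/val_inj.
  by case: k01 => ->; rewrite ?eqxx ?andbT /=;
    rewrite !(mulr1, mulr0, conjc0, mul0r, addr0, add0r).
have -> : \sum_(i < n) \sum_(j < n)
    (adj (v i) *m prepare e0 e1 z (X i j) *m v j) 0 0 =
  (e0 * ((1 + z) / 2))%:C * q 0 0 + (e1 * ((1 + z) / 2))%:C * q 1 0 +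
  (e0 * ((1 - z) / 2))%:C * q 0 1 + (e1 * ((1 - z) / 2))%:C * q 1 1.
  rewrite !qE !big_distrr -!big_split /=; apply: eq_bigr => i _.
  rewrite !big_distrr -!big_split /=; apply: eq_bigr => j _.
  rewrite form_mx2 !mxE /=.
  have -> : 1 / 2 + z / 2 = (1 + z) / 2 by ring.
  have -> : 1 / 2 - z / 2 = (1 - z) / 2 by ring.
  have -> : (0 +i* 0 : C) = 0 by [].
  have -> : (0 -i* 0 : C) = 0 by rewrite oppr0.
  rewrite !rmorphM /=; ring.
by rewrite !addr_ge0 // mulr_ge0 // ler0c !mulr_ge0 //; lra.
Qed.

(* The '+' effects are the identity for setting 0 and diag(1, e) for setting 1;
   z0, z1 are the states prepared after '+'. Both regimes of [B1_value] occur: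
   e = 1 gives the value 2, and e = 0 with z0 = - w, z1 = w the other one. *)
Definition two_prepare (e z0 z1 : R) (x a : bool) : 'M[C]_2 -> 'M[C]_2 :=
  let k := if x then e else 1 in
  if a then prepare 1 k (if x then z1 else z0) else prepare 0 (1 - k) 0.

Lemma two_prepare_instrument (e z0 z1 : R) : 0 <= e <= 1 ->
  -1 <= z0 <= 1 -> -1 <= z1 <= 1 -> is_instrument (two_prepare e z0 z1).
Proof.
move=> he hz0 hz1 x; split=> [a|A].
  by case: a x => [] []; split; (exact: prepare_linear || apply: prepare_cp; lra).
rewrite mxtraceD !tr_prepare tr_mx2 rmorphB rmorph0 rmorph1 /=.
by ring.
Qed.

Lemma two_prepare_feasible (p w e z0 z1 : R) : 0 <= p <= 1 -> 0 <= w <= 1 ->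
  0 <= e <= 1 -> z0 ^+ 2 = w ^+ 2 -> z1 ^+ 2 = w ^+ 2 ->
  feasible p w (two_prepare e z0 z1) (bl (1 / 2) (p / 2)).
Proof.
move=> hp hw he hz0 hz1.
have bnd (z : R) : z ^+ 2 = w ^+ 2 -> -1 <= z <= 1.
  move=> hz; rewrite -ler_norml -ler_sqr ?nnegrE // real_normK ?num_real //; nra.
have dz (z : R) : dot (0, 0, z) (0, 0, z) = z ^+ 2 by rewrite /dot /=; ring.
split; [split|split; [|split]].
- apply: bloch_psd; rewrite /len dz sqrtr_sqr ger0_norm; lra.
- by rewrite tr_bloch; congr (_%:C); field.
- by rewrite purity_bloch dz; congr (_%:C); field.
- by apply: two_prepare_instrument; auto.
move=> x; rewrite /post_state.
have tx : \tr (two_prepare e z0 z1 x true (bl (1 / 2) (p / 2))) =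
   ((1 + p) / 2 + (if x then e else 1) * ((1 - p) / 2))%:C.
  rewrite tr_prepare !mxE /= -!rmorphM -rmorphD; congr (_%:C); by case: (x); lra.
have k0 : 0 <= (if x then e else 1) by case: (x); lra.
(* The term [(1 + p) / 2] alone is positive, so the outcome occurs and normalizing returns the
   prepared state. *)
have tn : \tr (two_prepare e z0 z1 x true (bl (1 / 2) (p / 2))) != 0.
  rewrite tx (inj_eq (@complexI R)) gt_eqF // ltr_wpDr //.
    by apply: mulr_ge0 => //; lra.
  lra.
split=> //; move: tn; rewrite tr_prepare => tn.
rewrite /two_prepare /prepare scalerA mulVf // scale1r purity_bloch dz.
by congr (_%:C); case: (x) => /=; lra.
Qed.

Lemma B1_two_prepare (e z0 z1 p : R) :
  B1 (two_prepare e z0 z1) (bl (1 / 2) (p / 2)) =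
  (1 + ((1 + p) / 2 + e * ((1 - p) / 2)) * ((1 + z1) / 2 + e * ((1 - z1) / 2))
    + (1 - e) * ((1 - z0) / 2))%:C.
Proof.
rewrite /B1 /prob !tr_prepare !mxE /= -!(rmorphM, rmorphD) /=.
by congr (_%:C); field.
Qed.

Lemma B1_attained (p w : R) : 0 <= p <= 1 -> 0 <= w <= 1 ->
  exists Ins rho, feasible p w Ins rho /\ B1 Ins rho = (B1_value p w)%:C.
Proof.
move=> hp hw; rewrite /B1_value; case: ifP => _.
  exists (two_prepare 1 w w), (bl (1 / 2) (p / 2)); split.
    by apply: two_prepare_feasible => //; lra.
  by rewrite B1_two_prepare; congr (_%:C); field.
exists (two_prepare 0 (- w) w), (bl (1 / 2) (p / 2)); split.
  by apply: two_prepare_feasible => //; rewrite ?sqrrN //; lra.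
by rewrite B1_two_prepare; congr (_%:C); field.
Qed.
End Attained.

(* B_1(p,w) is the maximum of B1 over feasible configurations:
   an upper bound that is attained. *)
Theorem theorem2 (R : rcfType) (p w : R) :
  0 <= p <= 1 -> 0 <= w <= 1 ->
  (forall Ins rho, feasible p w Ins rho -> B1 Ins rho <= (B1_value p w)%:C) /\
  (exists Ins rho, feasible p w Ins rho /\ B1 Ins rho = (B1_value p w)%:C).
Proof.
move=> hp hw; split; last exact: B1_attained.
by move=> Ins rho; apply: B1_le.
Qed.
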